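(* Let $\alpha,\beta,\gamma\in\mathbb{Z}$ with $\gamma>0$ and $\alpha^\gamma\neq1\neq\beta^\gamma$, and let $p$ be a prime factor of $(\alpha^\gamma-1)(\beta^\gamma-1)$. Write $\gamma=p^nk$ with $n\ge 0$, $p\nmid k$, and let $q=|G/G_p|$. Then: (1) the Sylow $p$-subgroup $G_p$ of $G$ is generated by $a$ and $b$, subject to the defining relations $$a^{[a,b]}=a^{\alpha^\gamma},\quad b^{[b,a]}=b^{\beta^\gamma},\quad a^u=1,\quad b^v=1,$$ where $u$ and $v$ are the orders of $a$ and $b$ in $G_p$; (2) $N_p$ is the normal closure in $G_p$ of the $\gamma-1$ elements $[a^{\alpha^i},b^{\mu^i}][a,b]^{-1}$, $1\le i\le\gamma-1$; (3) $G_p/N_p$ is generated by elements $a_0,b_0$ (the cosets of $a,b$) subject to the defining relations $$a_0^{[a_0,b_0]}=a_0^{\alpha^\gamma},\quad b_0^{[b_0,a_0]}=b_0^{\beta^\gamma},\quad a_0^u=1,\quad b_0^v=1,\quad [a_0^{\alpha^i},b_0^{\mu^i}]=[a_0,b_0]\ \ (1\le i\le\gamma-1);$$ (4) $G_p/N_p$ imbeds as a normal subgroup of a Sylow $p$-subgroup $W_p$ of $W$; furthermore, $W_p$ is generated by elements $a_0,b_0,d_0$ subject to the defining relations listed in (3) together with $$a_0^{d_0}=a_0^{\alpha^{qk}},\quad b_0^{d_0}=b_0^{\mu^{qk}},\quad d_0^{p^n}=[a_0,b_0]^q,$$ and $W_p/\langle a_0,b_0\rangle$ is cyclic of order $p^n$.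 Thus $$|W_p|=p^n|G_p|/|N_p|.$$ In particular, if $p\nmid\gamma$, then $G_p/N_p$ is isomorphic to the sole Sylow $p$-subgroup of $W$.
   Context: Conventions: $x^y=y^{-1}xy$, ${}^y x=yxy^{-1}$, $[x,y]=x^{-1}y^{-1}xy$. $W=\langle X,Y,Z\mid X^Z=X^\alpha,\ {}^Z Y=Y^\beta,\ Z^\gamma=[X,Y]\rangle$ is the Wamsley group (finite), and $G=\langle A,B\mid A^{[A,B]}=A^{\alpha^\gamma},\ {}^{[A,B]}B=B^{\beta^\gamma}\rangle$ is the Macdonald group, which is known to be finite and nilpotent. $N$ is the kernel of the homomorphism $\Omega:G\to W$, $A\mapsto X$, $B\mapsto Y$. $G_p$ and $N_p=N\cap G_p$ are the Sylow $p$-subgroups of $G$ and $N$. $a,b$ are the images of $A,B$ under the canonical projection $G\to G_p$ of the nilpotent group $G$ onto its Sylow $p$-subgroup, and $a_0=aN_p$, $b_0=bN_p$. $\mu$ is a fixed integer that is inverse to $\beta$ modulo the order of $B$ in $G$ (hence also modulo the orders of $b$ and $b_0$). *)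

(* Defs.v *)
From HB Require Import structures.
From mathcomp Require Import all_boot all_order all_algebra.
From mathcomp Require Import all_fingroup all_solvable.

Set Implicit Arguments.
Unset Strict Implicit.
Unset Printing Implicit Defensive.

Import GroupScope.

Definition expgz (H : groupType) (x : H) (m : int) : H :=
  match m with
  | Posz n => x ^+ n
  | Negz n => x ^- n.+1
  end.

(* The group words and relations of mathcomp's [Presentation], evaluated in an
   arbitrary, possibly infinite, group; the library only evaluates them in
   finite groups. The word [Presentation.Cst i] is the i-th generator, and
   [Presentation.Idx] is the empty word. *)
Fixpoint eval_term (H : groupType) (e : seq H) (t : Presentation.term) : H :=
  match t with
  | Presentation.Cst i => nth 1 e i
  | Presentation.Idx => 1
  | Presentation.Inv t1 => (eval_term e t1)^-1
  | Presentation.Exp t1 n => eval_term e t1 ^+ n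
  | Presentation.Mul t1 t2 => eval_term e t1 * eval_term e t2
  | Presentation.Conj t1 t2 => eval_term e t1 ^ eval_term e t2
  | Presentation.Comm t1 t2 => [~ eval_term e t1, eval_term e t2]
  end.

Fixpoint holds (H : groupType) (e : seq H) (f : Presentation.formula) : Prop :=
  match f with
  | Presentation.Eq2 s t => eval_term e s = eval_term e t
  | Presentation.And f1 f2 => holds e f1 /\ holds e f2
  end.

Fixpoint all_hold (H : groupType) (e : seq H) (R : seq Presentation.formula) :
    Prop :=
  if R is f :: R' then holds e f /\ all_hold e R' else True.

(* [presented_by G x R]: the group G is generated by the elements listed in x
   subject to the defining relations R, i.e., G together with x has the
   universal property of the group < x | R > in the category of all groups
   (not only the finite ones, as opposed to [G \isog Grp _]). *)
Definition presented_by (gT : finGroupType) (G : {group gT}) (x : seq gT)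
    (R : seq Presentation.formula) : Prop :=
  [/\ <<[set:: x]>> = G,
      all_hold x R
    & forall (H : groupType) (y : seq H), size y = size x -> all_hold y R ->
        exists2 f : gT -> H,
          {in G &, {morph f : s t / s * t}} & [seq f s | s <- x] = y].

Definition normal_closure (gT : finGroupType) (S G : {set gT}) : {set gT} :=
  <<class_support S G>>.

(* The first projection of the decomposition G = 'O_p(G) \x 'O_p^'(G) of a
   finite nilpotent group, where 'O_p(G) is the Sylow p-subgroup of G. *)
Definition sylow_proj (gT : finGroupType) (p : nat) (G : {set gT}) (x : gT) :
    gT :=
  divgr 'O_p(G) 'O_p^'(G) x.

Lemma sylow_projP (gT : finGroupType) (p : nat) (G P : {group gT}) :
    nilpotent G -> p.-Sylow(G) P ->
  [/\ {in G &, {morph sylow_proj p G : x y / x * y}},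
      sylow_proj p G @: G = P & {in P, sylow_proj p G =1 id}].
Proof.
move=> nilG sylP; rewrite (nilpotent_Hall_pcore nilG sylP) /sylow_proj.
have /dprodP[_ defG cG tiG] := nilpotent_pcoreC p nilG.
have projK : {in 'O_p(G), divgr 'O_p(G) 'O_p^'(G) =1 id}.
  by move=> x; apply: divgr_id.
split=> //.
  by apply: (divgrM _ cG); apply/complP.
apply/setP=> x; apply/imsetP/idP => [[y Gy ->] | Px].
  by apply: mem_divgr; rewrite defG.
by exists x; rewrite ?projK // (subsetP (pcore_sub p G)).
Qed.

Section Relations.

Import Presentation.

Definition expz_term (t : term) (m : int) : term :=
  match m with
  | Posz n => Exp t n
  | Negz n => Inv (Exp t n.+1)
  end.

Variables (alpha beta mu : int) (gamma : nat).

Definition wamsley_rels : seq formula :=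
  let X := Cst 0 in let Y := Cst 1 in let Z := Cst 2 in
  [:: Eq2 (Conj X Z) (expz_term X alpha);
      Eq2 (Conj Y (Inv Z)) (expz_term Y beta);
      Eq2 (Exp Z gamma) (Comm X Y)].

Definition macdonald_rels : seq formula :=
  let A := Cst 0 in let B := Cst 1 in
  [:: Eq2 (Conj A (Comm A B)) (expz_term A (alpha ^+ gamma)%R);
      Eq2 (Conj B (Inv (Comm A B))) (expz_term B (beta ^+ gamma)%R)].

Definition sylow_macdonald_rels (u v : nat) : seq formula :=
  let a := Cst 0 in let b := Cst 1 in
  [:: Eq2 (Conj a (Comm a b)) (expz_term a (alpha ^+ gamma)%R);
      Eq2 (Conj b (Comm b a)) (expz_term b (beta ^+ gamma)%R);
      Eq2 (Exp a u) Idx;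
      Eq2 (Exp b v) Idx].

Definition quotient_rels (u v : nat) : seq formula :=
  let a0 := Cst 0 in let b0 := Cst 1 in
  sylow_macdonald_rels u v ++
  [seq Eq2 (Comm (expz_term a0 (alpha ^+ i)%R) (expz_term b0 (mu ^+ i)%R))
           (Comm a0 b0) | i <- iota 1 gamma.-1].

Definition sylow_wamsley_rels (u v p n k q : nat) : seq formula :=
  let a0 := Cst 0 in let b0 := Cst 1 in let d0 := Cst 2 in
  quotient_rels u v ++
  [:: Eq2 (Conj a0 d0) (expz_term a0 (alpha ^+ (q * k))%R);
      Eq2 (Conj b0 d0) (expz_term b0 (mu ^+ (q * k))%R);
      Eq2 (Exp d0 (p ^ n)%N) (Exp (Comm a0 b0) q)].

End Relations.

(* Main.v *)
Require Import Defs.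
From mathcomp Require Import all_boot all_order all_algebra.
From mathcomp Require Import all_fingroup all_solvable.

Import GRing.Theory GroupScope.

(* On the quotient of G by the normal closure M of the elements
   [A^(alpha^i), B^(mu^i)] [A, B]^-1, the assignment A |-> A^alpha, B |-> B^mu
   defines an endomorphism delta that fixes C = [A, B] and whose gamma-th power
   is conjugation by C. Hence G / M embeds in a cyclic extension <G / M, z> with
   z^gamma = C, which satisfies the relations of W. This shows at once that M is
   the kernel N of Omega and that the normal subgroup <X, Y> has index exactly
   gamma in W. As G is nilpotent, taking p-parts is a homomorphism from G onto
   G_p, which carries presentation and normal closure to G_p; and
   Omega(G_p) <Z^(q k)> is a Sylow p-subgroup of W, because <X, Y> is nilpotent
   and Z^(q k) has order p^n modulo <X, Y>. *)

(** * Integer powers in an arbitrary group *)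

Lemma expgzN {H : groupType} (x : H) m : expgz x (- m)%R = (expgz x m)^-1.
Proof. by case: m => [[|m]|m]; rewrite /= ?invg1 ?invgK. Qed.

Lemma expgzMn {H : groupType} (x : H) m (j : nat) :
  expgz x (m * j%:Z)%R = expgz x m ^+ j.
Proof.
case: m => m; first by rewrite -PoszM /= expgnA.
by rewrite NegzE mulNr -PoszM !expgzN /= expgnA expVgn.
Qed.

Lemma expgzM {H : groupType} (x : H) m j :
  expgz x (m * j)%R = expgz (expgz x m) j.
Proof.
case: j => j; first by rewrite expgzMn.
by rewrite NegzE mulrN !expgzN expgzMn.
Qed.

Lemma expgz_conj {H : groupType} (x y : H) m : expgz (x ^ y) m = expgz x m ^ y.
Proof. by case: m => m /=; rewrite ?conjVg conjXg. Qed.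

Lemma expgz_conj_iter {H : groupType} {x z : H} {m} i :
  x ^ z = expgz x m -> x ^ (z ^+ i) = expgz x (m ^+ i)%R.
Proof.
move=> xz; elim: i => [|i IHi]; first by rewrite conjg1.
by rewrite expgSr conjgM IHi -expgz_conj xz -expgzM -exprS.
Qed.

Lemma expgz1D {H : groupType} (x : H) m : expgz x (1 + m)%R = x * expgz x m.
Proof.
case: m => m; first by rewrite -PoszD /= expgS.
have ->: (1 + Negz m = - m%:Z)%R by rewrite NegzE -add1n PoszD opprD addNKr.
by rewrite expgzN /= expgSr invMg mulKVg.
Qed.

Lemma expgz_eq_mod1 {H : groupType} (x : H) (m : int) (d : nat) :
  x ^+ d = 1 -> (m = 1 %[mod d])%Z -> expgz x m = x.
Proof.
move=> xd1 /eqP; rewrite eqz_mod_dvd => /dvdzP[c mE].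
have ->: m = (1 + d%:Z * c)%R by rewrite mulrC -mE addrC subrK.
rewrite expgz1D expgzM /= xd1.
by case: c {mE} => c /=; rewrite expg1n ?invg1 mulg1.
Qed.

(** Put [w = x ^ z^-1], so that [x] is the [m]-th power of [w]. Then the [m']-th power of [x] is [w]
    to the power [m * m'], which is [w] because [w], a conjugate of [x], is also killed by [d]. This
    converts relations with [beta] into relations with [mu] and back. *)
Lemma expgz_conjV {H : groupType} {x z : H} {m m' : int} {d : nat} :
    x ^+ d = 1 -> (m * m' = 1 %[mod d])%Z ->
  x ^ z = expgz x m -> x ^ z^-1 = expgz x m'.
Proof.
move=> xd1 mm' xz; have xE: x = expgz (x ^ z^-1) m.
  by rewrite expgz_conj -xz conjgK.
rewrite {2}xE -expgzM (expgz_eq_mod1 _ _ d) //.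
by rewrite -conjXg xd1 conj1g.
Qed.

Lemma mem_expgz {gT : finGroupType} (G : {group gT}) x m :
  x \in G -> expgz x m \in G.
Proof. by case: m => m Gx /=; rewrite ?groupV groupX. Qed.

(** * Multiplicative maps from a finite group to an arbitrary group *)

(* The codomain H may be infinite, so that the morphisms of mathcomp, which
   require finite groups, do not apply. *)
Section Homomorphisms.

Context {gT : finGroupType} {G : {group gT}} {H : groupType} {f : gT -> H}.
Hypothesis fM : {in G &, {morph f : x y / x * y}}.

Lemma gmorph1 : f 1 = 1.
Proof. by apply: (mulgI (f 1)); rewrite -fM ?mulg1. Qed.

Lemma gmorphV : {in G, {morph f : x / x^-1}}.
Proof.
move=> x Gx; apply: (mulgI (f x)).
by rewrite -fM ?groupV // !mulgV gmorph1.
Qed.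

Lemma gmorphX j : {in G, {morph f : x / x ^+ j}}.
Proof.
move=> x Gx; elim: j => [|j IHj]; first exact: gmorph1.
by rewrite !expgS fM ?groupX ?IHj.
Qed.

Lemma gmorphJ : {in G &, {morph f : x y / x ^ y}}.
Proof.
by move=> x y Gx Gy; rewrite !conjgE !fM ?gmorphV ?groupM ?groupV.
Qed.

Lemma gmorphR : {in G &, {morph f : x y / [~ x, y]}}.
Proof.
move=> x y Gx Gy.
by rewrite !commgEl fM ?gmorphV ?gmorphJ ?groupV ?groupJ.
Qed.

Lemma gmorphXz m : {in G, {morph f : x / expgz x m}}.
Proof. by case: m => j x Gx /=; rewrite ?gmorphV ?groupX // gmorphX. Qed.

Lemma mem_eval_term (e : seq gT) t : all [in G] e -> eval_term e t \in G.
Proof.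
move=> Ge; elim: t => /= [i||t1 Gt1|t1 Gt1 j|t1 ? t2 ?|t1 ? t2 ?|t1 ? t2 ?].
- case: (ltnP i (size e)) => [lt_i_e | ?]; last by rewrite nth_default.
  exact: (allP Ge) (mem_nth 1 lt_i_e).
- exact: group1.
- by rewrite groupV.
- exact: groupX.
- exact: groupM.
- exact: groupJ.
exact: groupR.
Qed.

Lemma gmorph_eval_term (e : seq gT) t : all [in G] e ->
  f (eval_term e t) = eval_term (map f e) t.
Proof.
move=> Ge; have Gt := mem_eval_term e ^~ Ge.
elim: t => /= [i||t1 <-|t1 <- j|t1 <- t2 <-|t1 <- t2 <-|t1 <- t2 <-].
- case: (ltnP i (size e)) => ?; first by rewrite (nth_map 1).
  by rewrite !nth_default ?size_map // gmorph1.
- exact: gmorph1.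
- exact: gmorphV.
- exact: gmorphX.
- exact: fM.
- exact: gmorphJ.
exact: gmorphR.
Qed.

Lemma gmorph_all_hold (e : seq gT) R : all [in G] e ->
  all_hold e R -> all_hold (map f e) R.
Proof.
move=> Ge; have fh F: holds e F -> holds (map f e) F.
  elim: F => /= [s t|F1 IH1 F2 IH2 [/IH1 ? /IH2 ?]//].
  by rewrite -!gmorph_eval_term // => ->.
by elim: R => //= F R IHR [/fh ? /IHR ?].
Qed.

(** The elements of [G] that [f] kills form a subgroup, built by hand as [K]. *)
Lemma gmorph_ker_gen {S : {set gT}} :
  S \subset G -> {in S, forall x, f x = 1} -> {in <<S>>, forall x, f x = 1}.
Proof.
move=> sSG fS; pose K := [set x in G | f x == 1]; have gK: group_set K.
  apply/group_setP; split=> [|x y]; rewrite ?inE ?group1 ?gmorph1 ?eqxx //.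
  move=> /andP[Gx /eqP fx] /andP[Gy /eqP fy].
  by rewrite groupM //= fM // fx fy mulg1 eqxx.
have sK: <<S>> \subset K.
  rewrite (gen_subG _ (Group gK)); apply/subsetP=> x Sx.
  by rewrite inE (subsetP sSG) //= fS // eqxx.
by move=> x /(subsetP sK); rewrite inE => /andP[_ /eqP].
Qed.

Lemma gmorph_ker_normal_closure {S : {set gT}} :
    S \subset G -> {in S, forall x, f x = 1} ->
  {in normal_closure S G, forall x, f x = 1}.
Proof.
move=> sSG fS; apply: gmorph_ker_gen.
  exact: class_support_sub_norm sSG (normG G).
move=> _ /imset2P[x y Sx Gy ->].
by rewrite gmorphJ ?(subsetP sSG x) // fS // conj1g.
Qed.

(** The induced map evaluates [f] at a representative of the coset; two representatives differ by a
    left factor in [N], which [f] kills. *)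
Lemma gmorph_quotient {N : {group gT}} :
    N <| G -> {in N, forall x, f x = 1} ->
  exists2 g : coset_of N -> H,
    {in G / N &, {morph g : x y / x * y}}
    & {in G, forall x, g (coset N x) = f x}.
Proof.
case/andP=> sNG nNG fN; pose g xb := f (repr xb).
have gE: {in G, forall x, g (coset N x) = f x}.
  move=> x Gx; rewrite /g.
  have: repr (coset N x) \in N :* x.
    by rewrite -val_coset ?(subsetP nNG x) ?mem_repr_coset.
  by case/rcosetP=> y Ny ->; rewrite fM ?(subsetP sNG y Ny) // fN // mul1g.
exists g => // _ _ /morphimP[x Nx Gx ->] /morphimP[y Ny Gy ->].
by rewrite -morphM // !gE ?fM ?groupM.
Qed.

End Homomorphisms.

Lemma gmorph_eq_gen {gT : finGroupType} {H : groupType} {f g : gT -> H}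
    (G : {group gT}) (S : {set gT}) :
    {in G &, {morph f : x y / x * y}} -> {in G &, {morph g : x y / x * y}} ->
  S \subset G -> {in S, f =1 g} -> {in <<S>>, f =1 g}.
Proof.
move=> fM gM sSG fgS; pose K := [set x in G | f x == g x]; have gK: group_set K.
  apply/group_setP; split=> [|x y]; rewrite ?inE ?group1.
    by rewrite (gmorph1 fM) (gmorph1 gM) eqxx.
  move=> /andP[Gx /eqP fx] /andP[Gy /eqP fy].
  by rewrite groupM //= fM // gM // fx fy eqxx.
have sK: <<S>> \subset K.
  rewrite (gen_subG _ (Group gK)); apply/subsetP=> x Sx.
  by rewrite inE (subsetP sSG) //= fgS // eqxx.
by move=> x /(subsetP sK); rewrite inE => /andP[_ /eqP].
Qed.

(** * Evaluation of words, and normal closures *)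

Lemma eval_expz_term {H : groupType} (e : seq H) t m :
  eval_term e (expz_term t m) = expgz (eval_term e t) m.
Proof. by case: m. Qed.

Lemma all_hold_cat {H : groupType} (e : seq H) R1 R2 :
  all_hold e (R1 ++ R2) <-> all_hold e R1 /\ all_hold e R2.
Proof. by elim: R1 => /= [|F R1 IHR]; tauto. Qed.

Lemma normal_closure_norm {gT : finGroupType} (S : {set gT}) (G : {group gT}) :
  G \subset 'N(normal_closure S G).
Proof. exact: subset_trans (class_support_norm S G) (norm_gen _). Qed.

Lemma expgz_conjX {H : groupType} {x z : H} {m} j :
  x ^ z = expgz x m -> (x ^+ j) ^ z = expgz (x ^+ j) m.
Proof.
by rewrite conjXg => ->; rewrite -expgzMn mulrC expgzM.
Qed.

(** * Cyclic extensions, and extending a homomorphism by one generator *)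

Section CyclicExtension.

Context {gT : finGroupType} {delta : gT -> gT} {c : gT} {m : nat}.
Hypotheses (deltaM : {morph delta : x y / x * y}) (delta_c : delta c = c).
Hypothesis delta_iter : forall x, iter m.+1 delta x = x ^ c.

(** Right multiplication by [z] on formal products [z ^+ i * h]: passing [z] to the left of [h]
    applies [delta], and the carry in the exponent of [z] becomes a factor [c], since [z ^+ m.+1] is
    to be [c]. *)
Definition ext_step (u : 'I_m.+1 * gT) : 'I_m.+1 * gT :=
  (inord (u.1.+1 %% m.+1), c ^+ (u.1.+1 %/ m.+1) * delta u.2).

Lemma ext_step_iter j u : iter j ext_step u =
  (inord ((u.1 + j) %% m.+1), c ^+ ((u.1 + j) %/ m.+1) * iter j delta u.2).
Proof.
case: u => i h; elim: j => [|j /= ->] /=.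
  by rewrite addn0 modn_small // divn_small // mul1g inord_val.
have deltaMm: {in [set: gT] &, {morph delta : x y / x * y}} by move=> x y _ _.
rewrite /ext_step /= inordK ?ltn_pmod // deltaM (gmorphX deltaMm) ?inE //.
rewrite delta_c mulgA -expgnDr addnS; congr (inord _, _ ^+ _ * _).
  by rewrite -addn1 modnDml addn1.
(* The carries add up: the quotient of [i + j + 1] is that of [i + j] plus the carry of its
   remainder. *)
by rewrite {3}(divn_eq (i + j) m.+1) -addnS divnMDl // addnC.
Qed.

(** A full turn sends [h] to [c * h ^ c = h * c], by the hypothesis on the iterate of [delta]. *)
Lemma ext_step_cycle u : iter m.+1 ext_step u = (u.1, u.2 * c).
Proof.
rewrite ext_step_iter modnDr modn_small // divnDr // divn_small //.
by rewrite divnn inord_val delta_iter conjgE mulVKg.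
Qed.

(** An iterate of the step is a right translation, hence injective; no inverse of [delta] has to be
    exhibited. *)
Lemma ext_step_inj : injective ext_step.
Proof.
move=> u v uv; have: iter m.+1 ext_step u = iter m.+1 ext_step v.
  by rewrite !iterSr uv.
by rewrite !ext_step_cycle; case: u v {uv} => [i h] [j l] /= [-> /mulIg->].
Qed.

Lemma ext_trans_inj x : injective (fun u : 'I_m.+1 * gT => (u.1, u.2 * x)).
Proof. by move=> [i h] [j l] [-> /mulIg->]. Qed.

(* The extension acts on pairs (i, h), which stand for the products z ^+ i * h,
   by right multiplication. *)
Lemma cyclic_extension :
  exists (eT : finGroupType) (r : gT -> eT) (z : eT),
    [/\ {morph r : x y / x * y}, injective r,
        forall x, r x ^ z = r (delta x),
        z ^+ m.+1 = r c
      & forall i x, z ^+ i = r x -> m.+1 %| i].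
Proof.
pose z := perm ext_step_inj; pose r x := perm (ext_trans_inj x).
have zX j u : (z ^+ j) u = iter j ext_step u.
  by rewrite permX; apply: eq_iter => v; rewrite permE.
exists {perm 'I_m.+1 * gT}, r, z; split.
- by move=> x y; apply/permP=> u; rewrite permM !permE /= mulgA.
- move=> x y /permP/(_ (ord0, 1)); rewrite !permE /= !mul1g.
  by case.
- move=> x; apply: (mulgI z); rewrite -conjgC.
  by apply/permP=> u; rewrite !permM !permE /= /ext_step /= deltaM mulgA.
- by apply/permP=> u; rewrite zX ext_step_cycle permE.
(* At [(ord0, 1)], the first coordinate becomes [i %% m.+1] under [z ^+ i] and stays [0] under
   [r x]. *)
move=> i x /permP/(_ (ord0, 1)); rewrite zX ext_step_iter permE /= add0n.
by case=> /(congr1 val); rewrite /= inordK ?ltn_pmod // => /eqP.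
Qed.

End CyclicExtension.

(** The extension sends [x * d ^+ i] to [f x * e ^+ i]. It is well defined because [f] agrees with
    the powers of [e] on the powers of [d] in [J], and multiplicative because [f] turns conjugation
    by [d] into conjugation by [e]. *)
Lemma gmorph_extend_cycle {gT : finGroupType} {H : groupType} {J : {group gT}}
    {d : gT} {f : gT -> H} {e : H} :
    {in J &, {morph f : x y / x * y}} -> d \in 'N(J) ->
    {in J, forall x, f (x ^ d) = f x ^ e} ->
    (forall i, d ^+ i \in J -> f (d ^+ i) = e ^+ i) ->
  exists F : gT -> H,
    [/\ {in J <*> <[d]> &, {morph F : x y / x * y}}, {in J, F =1 f} & F d = e].
Proof.
move=> fM nJd fJ fX.
have nJX i : d ^+ i \in 'N(J) by apply: groupX.
have fJX i : {in J, forall x, f (x ^ (d ^+ i)) = f x ^ (e ^+ i)}.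
  move=> x Jx; elim: i => [|i IHi]; first by rewrite !conjg1.
  by rewrite !expgSr !conjgM fJ ?IHi // memJ_norm.
(* The value 1 is a default for elements that are not of the form [x * d ^+ i]; [FE] shows that the
   exponent picked does not matter. *)
pose F w := if [pick i : 'I_#[d] | w * d ^- i \in J] is Some i
            then f (w * d ^- i) * e ^+ i else 1.
have FE x i : x \in J -> F (x * d ^+ i) = f x * e ^+ i.
  have lt_d := ltn_pmod i (order_gt0 d).
  move=> Jx; rewrite /F; case: pickP => [l | /(_ (Ordinal lt_d))].
    (* Two exponents [i] and [l] for one element give [d ^+ i * d ^- l] in [J]. As exponents are
       natural numbers, the sign of [i - l] splits the argument. *)
    rewrite -mulgA (groupMl _ Jx) => Jil; case: (leqP l i) => il.
      have dil: d ^+ i * d ^- l = d ^+ (i - l) by rewrite expgnFr.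
      by rewrite dil in Jil *; rewrite fM // fX // -mulgA -expgnDr subnK.
    have dil: d ^+ i * d ^- l = d ^- (l - i).
      by rewrite expgnFr ?(ltnW il) // invMg invgK.
    rewrite dil groupV in Jil *.
    rewrite fM ?groupV // (gmorphV fM) // fX //.
    by rewrite -mulgA -{2}(subnKC (ltnW il)) -[(i + _)%N]addnC expgnDr mulKg.
  by rewrite /= expg_mod_order mulgK Jx.
exists F; split=> [w1 w2|x Jx|].
- rewrite norm_joinEr ?cycle_subG //.
  case/mulsgP=> x _ Jx /cycleP[i ->] ->.
  case/mulsgP=> y _ Jy /cycleP[l ->] -> {w1 w2}.
  have Jy': y ^ d ^- i \in J by rewrite memJ_norm // groupV.
  have ->: x * d ^+ i * (y * d ^+ l) = x * y ^ d ^- i * d ^+ (i + l).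
    by rewrite conjgE invgK expgnDr !mulgA mulgVK.
  have fy: f y = f (y ^ d ^- i) ^ (e ^+ i) by rewrite -fJX // conjgKV.
  by rewrite !FE ?(groupM Jx Jy') // fM // fy conjgE expgnDr !mulgA mulgK.
- by have:= FE x 0 Jx; rewrite !expg0 !mulg1.
by have:= FE 1 1%N (group1 J); rewrite !expg1 (gmorph1 fM) !mul1g.
Qed.

Lemma set_seq2 {T : finType} (x y : T) : [set:: [:: x; y]] = [set x; y].
Proof. by apply/setP=> z; rewrite !inE. Qed.

(** * The projection of a nilpotent group onto its Sylow subgroup *)

Section SylowProjection.

Context {gT : finGroupType} {p : nat} {G P : {group gT}}.
Hypotheses (nilG : nilpotent G) (sylP : p.-Sylow(G) P).

Lemma nilpotent_Sylow_normal : P <| G.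
Proof. by rewrite (nilpotent_Hall_pcore nilG sylP) pcore_normal. Qed.

Lemma sylow_projM : {in G &, {morph sylow_proj p G : x y / x * y}}.
Proof. by have [] := sylow_projP nilG sylP. Qed.

Lemma sylow_proj_id : {in P, sylow_proj p G =1 id}.
Proof. by have [] := sylow_projP nilG sylP. Qed.

Lemma sylow_proj_mem x : x \in G -> sylow_proj p G x \in P.
Proof.
by move=> Gx; have [_ <- _] := sylow_projP nilG sylP; apply: imset_f.
Qed.

(** The projection fixes the p-part of [x], which lies in the normal Sylow subgroup [P], and sends
    the p'-part to an element that is both a p- and a p'-element, hence trivial. So the projection
    of [x] is a power of [x]. *)
Lemma sylow_projE : {in G, forall x, sylow_proj p G x = x.`_p}.
Proof.
move=> x Gx; have Gc pi: x.`_pi \in G by apply: groupX.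
rewrite -{1}(consttC p x) sylow_projM ?Gc //.
have Pxp: x.`_p \in P.
  by rewrite (mem_normal_Hall sylP nilpotent_Sylow_normal) ?p_elt_constt ?Gc.
rewrite (sylow_proj_id _ Pxp); set y := sylow_proj _ _ _.
have y_p: p.-elt y by apply: mem_p_elt (pHall_pgroup sylP) (sylow_proj_mem _ _).
have y_p': p^'.-elt y.
  apply: pnat_dvd (p_elt_constt p^' x).
  rewrite order_dvdn -(gmorphX sylow_projM) // expg_order.
  by rewrite (gmorph1 sylow_projM).
have /eqP-> : y == 1 by rewrite -order_eq1 (pnat_1 y_p y_p').
exact: mulg1.
Qed.

Lemma sylow_proj_normal (N : {group gT}) :
  N <| G -> sylow_proj p G @: N = N :&: P.
Proof.
case/andP=> sNG _; apply/setP=> x; apply/imsetP/setIP => [[y Ny ->] | [Nx Px]].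
  by rewrite sylow_proj_mem ?(subsetP sNG y Ny) // sylow_projE ?groupX //
    (subsetP sNG).
by exists x; rewrite ?sylow_proj_id.
Qed.

Let proj : {morphism G >-> gT} := Morphism sylow_projM.

Lemma sylow_proj_gen (S : {set gT}) :
  S \subset G -> sylow_proj p G @: <<S>> = <<sylow_proj p G @: S>>.
Proof.
move=> sSG; have:= morphim_gen proj sSG.
by rewrite !morphimEsub // gen_subG.
Qed.

Lemma sylow_proj_normal_closure (S : {set gT}) : S \subset G ->
  sylow_proj p G @: normal_closure S G = normal_closure (sylow_proj p G @: S) P.
Proof.
move=> sSG; rewrite sylow_proj_gen; last first.
  exact: class_support_sub_norm sSG (normG G).
congr <<_>>; apply/setP=> x; apply/imsetP/imset2P.
  case=> _ /imset2P[y z Sy Gz ->] ->.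
  exists (sylow_proj p G y) (sylow_proj p G z) => //.
  - exact: imset_f.
  - exact: sylow_proj_mem.
  by rewrite (gmorphJ sylow_projM) // (subsetP sSG).
(* A conjugator in [P] is its own projection. *)
case=> _ z /imsetP[y Sy ->] Pz ->; exists (y ^ z); last first.
  have Gz := subsetP (pHall_sub sylP) z Pz.
  by rewrite (gmorphJ sylow_projM) ?(subsetP sSG y) // (sylow_proj_id _ Pz).
by apply: imset2_f; rewrite // (subsetP (pHall_sub sylP)).
Qed.

(** The power on the left lies in [P], so the projection fixes it. This is the source of the
    exponent [q] in the relation for [d0 ^+ (p ^ n)]. *)
Lemma expg_sylow_proj x : x \in G ->
  x ^+ #|G / P| = sylow_proj p G x ^+ #|G / P|.
Proof.
move=> Gx; rewrite -(gmorphX sylow_projM) // sylow_proj_id //.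
have nPx := subsetP (normal_norm nilpotent_Sylow_normal) x Gx.
apply: coset_idr; first exact: groupX.
by rewrite morphX // expg_cardG // mem_quotient.
Qed.

End SylowProjection.

(** The exponent that turns [x] into its pi-part is 1 modulo the order of that part. Hence a
    homomorphism sending [x] to [y] sends the pi-part of [x] to [y] too. *)
Lemma expg_constt_eq1 {H : groupType} {gT : finGroupType} (x : gT) (y : H) pi :
  y ^+ #[x.`_pi] = 1 -> y ^+ (chinese #[x]`_pi #[x]`_pi^' 1 0) = y.
Proof.
rewrite order_constt => y1; set c := chinese _ _ _ _.
have c1: c = 1 %[mod #[x]`_pi] by rewrite /c chinese_modl ?coprime_partC.
rewrite [c](divn_eq _ #[x]`_pi) c1 expgnDr mulnC expgnA y1 expg1n mul1g.
(* If the pi-part of the order is 1, the residue of 1 is 0 rather than 1, but then [y] is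
   trivial. *)
case: (#[x]`_pi)%N y1 => [|[|m]] y1; first by [].
  by rewrite (y1 : y = 1) expg1n.
by rewrite modn_small.
Qed.

Lemma all_hold_map {H : groupType} (e : seq H) (F : nat -> Presentation.formula)
    (s : seq nat) :
  all_hold e [seq F i | i <- s] <-> (forall i, i \in s -> holds e (F i)).
Proof.
elim: s => [|j s IHs] /=; first by split.
case: IHs => IH1 IH2; split=> [[Fj /IH1 Fs] i | Fs].
  by rewrite inE => /predU1P[->|/Fs].
by split=> [|]; [|apply: IH2 => i si]; apply: Fs; rewrite inE ?eqxx ?si ?orbT.
Qed.

(** * The relator lists of the Sylow subgroups, as equations *)

Section Relators.

Context (alpha beta mu : int) (gamma : nat) {H : groupType} (e : seq H).
Context (u v : nat).
Let x := nth 1 e 0.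
Let y := nth 1 e 1.

Lemma sylow_macdonald_relsP :
  all_hold e (sylow_macdonald_rels alpha beta gamma u v) <->
  [/\ x ^ [~ x, y] = expgz x (alpha ^+ gamma)%R,
      y ^ [~ y, x] = expgz y (beta ^+ gamma)%R, x ^+ u = 1 & y ^+ v = 1].
Proof. by rewrite /= !eval_expz_term /=; split=> [[? [? [? [? _]]]] | []]. Qed.

Lemma quotient_relsP :
  all_hold e (quotient_rels alpha beta mu gamma u v) <->
  all_hold e (sylow_macdonald_rels alpha beta gamma u v) /\
  (forall i, 1 <= i < gamma ->
    [~ expgz x (alpha ^+ i)%R, expgz y (mu ^+ i)%R] = [~ x, y]).
Proof.
rewrite /quotient_rels; split=> [/all_hold_cat[? /all_hold_map Rxy]|[? Rxy]].
  split=> // i.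
  case/andP=> i_gt0 lti; have := Rxy i; rewrite /= !eval_expz_term mem_iota.
  by apply; rewrite i_gt0 add1n prednK // (leq_trans _ lti).
apply/all_hold_cat; split=> //; apply/all_hold_map => i.
rewrite mem_iota /= !eval_expz_term => /andP[i_gt0 lti]; apply: Rxy.
by rewrite i_gt0; case: gamma lti; rewrite // ltnNge i_gt0.
Qed.

Lemma sylow_wamsley_relsP (p n k q : nat) (d := nth 1 e 2) :
  all_hold e (sylow_wamsley_rels alpha beta mu gamma u v p n k q) <->
  [/\ all_hold e (quotient_rels alpha beta mu gamma u v),
      x ^ d = expgz x (alpha ^+ (q * k))%R, y ^ d = expgz y (mu ^+ (q * k))%R
    & d ^+ (p ^ n) = [~ x, y] ^+ q].
Proof.
split=> [/all_hold_cat[? [xd [yd [? _]]]] | [? xd yd ?]].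
  by rewrite /= !eval_expz_term /= in xd yd.
rewrite /sylow_wamsley_rels; apply/all_hold_cat.
by split=> //; split; last split=> //; rewrite /= eval_expz_term.
Qed.

End Relators.

Lemma modz_expr1 (x : int) (d j : nat) :
  (x = 1 %[mod d])%Z -> ((x ^+ j)%R = 1 %[mod d])%Z.
Proof. by move=> xd; rewrite -modzXm xd modzXm expr1n. Qed.

(** * Relations in [G] and [W]; the relators die in [W] *)

Section MacdonaldWamsley.

Context {alpha beta mu : int} {gamma p n k : nat}.
Context {W : finGroupType} {X Y Z : W} {G : finGroupType} {A B : G}.
Context {Omega : {morphism [set: G] >-> W}} {Gp : {group G}}.
Hypothesis gamma_gt0 : (0 < gamma)%N.
Hypothesis p_prime : prime p.
Hypothesis gammaE : gamma = (p ^ n * k)%N.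
Hypothesis p_ndvd_k : ~~ (p %| k)%N.
Hypothesis W_pres :
  presented_by [set: W] [:: X; Y; Z] (wamsley_rels alpha beta gamma).
Hypothesis G_pres :
  presented_by [set: G] [:: A; B] (macdonald_rels alpha beta gamma).
Hypothesis G_nil : nilpotent [set: G].
Hypotheses (OmegaA : Omega A = X) (OmegaB : Omega B = Y).
Hypothesis mu_inv : ((mu * beta)%R = 1 %[mod #[B]])%Z.
Hypothesis Gp_sylow : p.-Sylow([set: G]) Gp.

(** The image of [[~ x, y]] under the [i]-th iterate of an endomorphism that raises [x] to the power
    [alpha] and [y] to the power [mu]. *)
Definition twisted_comm {H : groupType} (x y : H) (i : nat) : H :=
  [~ expgz x (alpha ^+ i)%R, expgz y (mu ^+ i)%R].

(** Stated for any pair, since the projection to [Gp] carries the set for [A], [B] to the set for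
    [a], [b]. *)
Definition comm_defects {gT : finGroupType} (x y : gT) : {set gT} :=
  [set twisted_comm x y i * [~ x, y]^-1 | i : 'I_gamma & (1 <= i)%N].

Lemma mu_invX j : ((beta ^+ j * mu ^+ j)%R = 1 %[mod #[B]])%Z.
Proof. by rewrite mulrC -exprMn modz_expr1. Qed.

Lemma gen_AB : <<[set:: [:: A; B]]>> = [set: G].
Proof. by case: G_pres. Qed.

Lemma A_conj : A ^ [~ A, B] = expgz A (alpha ^+ gamma)%R.
Proof. by case: G_pres => _ [+ _] _; rewrite /= eval_expz_term. Qed.

Lemma B_conjV : B ^ [~ A, B]^-1 = expgz B (beta ^+ gamma)%R.
Proof. by case: G_pres => _ [_ [+ _]] _; rewrite /= eval_expz_term. Qed.

Lemma B_conj : B ^ [~ A, B] = expgz B (mu ^+ gamma)%R.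
Proof.
rewrite -[[~ A, B]]invgK.
exact: (expgz_conjV (expg_order B) (mu_invX gamma) B_conjV).
Qed.

Lemma X_conj : X ^ Z = expgz X alpha.
Proof. by case: W_pres => _ [+ _] _; rewrite /= eval_expz_term. Qed.

Lemma Y_conj : Y ^ Z = expgz Y mu.
Proof.
(* Since [Y] is the image of [B], it is killed by [#[B]], modulo which [mu] inverts [beta]. *)
rewrite -[Z]invgK; apply: (expgz_conjV (d := #[B])) (mu_invX 1) _.
  by rewrite -OmegaB -morphX ?inE // expg_order morph1.
by case: W_pres => _ [_ [+ _]] _; rewrite /= eval_expz_term.
Qed.

Lemma Z_gamma : Z ^+ gamma = [~ X, Y].
Proof. by case: W_pres => _ [_ [_ []]]. Qed.

Lemma OmegaM : {in [set: G] &, {morph Omega : x y / x * y}}.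
Proof. exact: morphM. Qed.

(** In [W] the twisted commutator is the conjugate of [[~ X, Y]] by [Z ^+ i], and [[~ X, Y] = Z ^+
    gamma] commutes with [Z ^+ i]. *)
Lemma defects_sub_ker :
  {in normal_closure (comm_defects A B) [set: G], forall x, Omega x = 1}.
Proof.
apply: (gmorph_ker_normal_closure (G := [set: G]%G) OmegaM).
  exact: subsetT.
move=> _ /imsetP[i _ ->]; rewrite /twisted_comm.
rewrite morphM ?morphV ?morphR ?inE // !(gmorphXz OmegaM) ?inE //.
rewrite OmegaA OmegaB -(expgz_conj_iter _ X_conj) -(expgz_conj_iter _ Y_conj).
rewrite -conjRg -Z_gamma; have/conjg_fixP->: [~ Z ^+ gamma, Z ^+ i] == 1.
  exact/commgP/commuteX2.
exact: mulgV.
Qed.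

(** * The twist of [G / M], the kernel of [Omega], and the index of its image *)

Let M := <<class_support (comm_defects A B) [set: G]>>%G.
Let abar := coset M A.
Let bbar := coset M B.

Lemma M_normal : M <| [set: G].
Proof. by rewrite /normal subsetT normal_closure_norm. Qed.

Lemma cosetM : {in [set: G] &, {morph coset M : x y / x * y}}.
Proof.
move=> x y Gx Gy; have nMG := subsetP (normal_norm M_normal).
by rewrite morphM ?nMG.
Qed.

Lemma abar_conj : abar ^ [~ abar, bbar] = expgz abar (alpha ^+ gamma)%R.
Proof.
rewrite -(gmorphR cosetM) ?inE // -(gmorphJ cosetM) ?inE // A_conj.
by rewrite (gmorphXz cosetM) ?inE.
Qed.

Lemma bbar_conj : bbar ^ [~ abar, bbar] = expgz bbar (mu ^+ gamma)%R.
Proof.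
rewrite -(gmorphR cosetM) ?inE // -(gmorphJ cosetM) ?inE // B_conj.
by rewrite (gmorphXz cosetM) ?inE.
Qed.

Lemma bbar_conjV :
  bbar ^ [~ abar, bbar]^-1 = expgz bbar (beta ^+ gamma)%R.
Proof.
rewrite -(gmorphR cosetM) ?inE // -(gmorphV cosetM) ?inE //.
by rewrite -(gmorphJ cosetM) ?inE // B_conjV (gmorphXz cosetM) ?inE.
Qed.

(** Below [gamma] this is the definition of [M], or trivial for [i = 0]. At [i = gamma] the twisted
    commutator is the conjugate of [[~ abar, bbar]] by itself. *)
Lemma twisted_comm_bar {i} :
  i <= gamma -> twisted_comm abar bbar i = [~ abar, bbar].
Proof.
rewrite leq_eqVlt => /predU1P[-> | lti].
  by rewrite /twisted_comm -abar_conj -bbar_conj -conjRg conjgE mulKg.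
case: i lti => [|i] lti //; apply: divg1_eq.
rewrite /twisted_comm -!(gmorphXz cosetM) ?inE //.
rewrite -!(gmorphR cosetM) ?inE // -(gmorphV cosetM) ?inE //.
rewrite -cosetM ?inE //.
apply: coset_id; apply: (mem_gen (mem_class_support [set: G] _)).
by apply/imsetP; exists (Ordinal lti); rewrite ?inE.
Qed.

(** The images proposed for [A] and [B] satisfy the relations of [G] because their commutator is
    still [[~ abar, bbar]]. The resulting map kills [M]: it shifts the index of a twisted commutator
    from [i] to [i.+1], which may reach [gamma]. *)
Lemma twist_bar : exists delta : coset_of M -> coset_of M,
  [/\ {morph delta : x y / x * y},
      delta abar = expgz abar alpha & delta bbar = expgz bbar mu].
Proof.
have comm1 : [~ expgz abar alpha, expgz bbar mu] = [~ abar, bbar].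
  by rewrite -(twisted_comm_bar gamma_gt0).
case: G_pres => _ _ /(_ _ [:: expgz abar alpha; expgz bbar mu]) [//||f fM].
  split; last split; rewrite //= eval_expz_term /= comm1.
    by rewrite -expgz_conj abar_conj -!expgzM mulrC.
  by rewrite -expgz_conj bbar_conjV -!expgzM mulrC.
case=> fA fB; case: (gmorph_quotient fM M_normal) => [|g gM gE].
  apply: (gmorph_ker_normal_closure fM); first exact: subsetT.
  move=> _ /imsetP[i _ ->]; rewrite fM ?inE // (gmorphV fM) ?inE //.
  rewrite /twisted_comm !(gmorphR fM) ?inE // !(gmorphXz fM) ?inE // fA fB.
  rewrite -!expgzM -!exprS comm1; apply: (canLR (mulgK _)); rewrite mul1g.
  exact: (twisted_comm_bar (ltn_ord i)).
exists g; split=> [x y||]; rewrite ?gE ?inE //.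
by apply: gM; rewrite quotientT inE.
Qed.

(** Here [E] is the cyclic extension of [G / M] by [z]. It satisfies the relations of [W], which
    gives [g]; the kernel and the index are then read off in [E]. *)
Lemma bar_extension :
  exists (E : finGroupType) (r : coset_of M -> E) (g : W -> E),
    [/\ {morph r : x y / x * y}, injective r,
        {morph g : x y / x * y},
        forall x, g (Omega x) = r (coset M x)
      & forall i x, g Z ^+ i = r x -> gamma %| i].
Proof.
have [delta [deltaM delta_a delta_b]] := twist_bar.
have deltaMm: {in [set: coset_of M] &, {morph delta : x y / x * y}}.
  by move=> x y _ _.
have comm1 : [~ expgz abar alpha, expgz bbar mu] = [~ abar, bbar].
  by rewrite -(twisted_comm_bar gamma_gt0).
have delta_c : delta [~ abar, bbar] = [~ abar, bbar].
  by rewrite (gmorphR deltaMm) ?inE // delta_a delta_b.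
have delta_iterM j : {morph iter j delta : x y / x * y}.
  by move=> x y; elim: j => //= j ->.
have delta_Xz j x m :
    delta x = expgz x m -> iter j delta x = expgz x (m ^+ j)%R.
  move=> xm; elim: j => //= j ->.
  by rewrite (gmorphXz deltaMm) ?inE // xm -expgzM -exprS.
(* Both sides are multiplicative in [x], so a check on the images of [A] and [B] suffices. *)
have delta_iter x : iter gamma delta x = x ^ [~ abar, bbar].
  rewrite -[x]coset_reprK; move: (repr x) => {}x.
  have: x \in <<[set:: [:: A; B]]>> by rewrite gen_AB inE.
  pose f y := iter gamma delta (coset M y).
  pose h y := coset M y ^ [~ abar, bbar].
  apply: (gmorph_eq_gen (f := f) (g := h) [set: G]%G) => [y t ? ?|y t ? ?||].
  - by rewrite /f cosetM // delta_iterM.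
  - by rewrite /h cosetM // conjMg.
  - exact: subsetT.
  move=> y; rewrite !inE => /orP[] /eqP->; rewrite /f /h.
    by rewrite (delta_Xz _ _ alpha) // abar_conj.
  by rewrite (delta_Xz _ _ mu) // bbar_conj.
case: (gamma) (gamma_gt0) delta_iter W_pres => // m _ delta_iter.
have [E [r [z [rM rI rz zm zi]]]] :=
  cyclic_extension deltaM delta_c delta_iter.
have rMm: {in [set: coset_of M] &, {morph r : x y / x * y}}.
  by move=> x y _ _.
case=> _ _ /(_ _ [:: r abar; r bbar; z]) [//||g gM [gX gY gZ]].
  split; last split; last split; rewrite //= ?eval_expz_term /=.
  - by rewrite rz delta_a (gmorphXz rMm) ?inE.
  (* [z] acts on [r bbar] by the power [mu]; its inverse acts by [beta], since [#[B]] kills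
     [r bbar]. *)
  - apply: (expgz_conjV (m := mu) (d := #[B])) => //.
      rewrite -(gmorphX rMm) ?inE // -(gmorphX cosetM) ?inE // expg_order.
      by rewrite (gmorph1 cosetM) (gmorph1 rMm).
    by rewrite rz delta_b (gmorphXz rMm) ?inE.
  by rewrite zm (gmorphR rMm) ?inE.
exists E, r, g; split=> // [x y | x | i x].
- by rewrite gM ?inE.
- have: x \in <<[set:: [:: A; B]]>> by rewrite gen_AB inE.
  pose f y := g (Omega y); pose h y := r (coset M y).
  apply: (gmorph_eq_gen (f := f) (g := h) [set: G]%G) => [y t ? ?|y t ? ?||].
  - by rewrite /f OmegaM ?gM ?inE.
  - by rewrite /h cosetM // rM.
  - exact: subsetT.
  by move=> y; rewrite !inE => /orP[] /eqP->; rewrite /f /h ?OmegaA ?OmegaB.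
by rewrite gZ; apply: zi.
Qed.

Lemma ker_macdonald_wamsley :
  'ker Omega = normal_closure (comm_defects A B) [set: G].
Proof.
have [E [r [g [rM rI gM gE _]]]] := bar_extension.
apply/setP=> x; apply/idP/idP => [/mker Ox | /defects_sub_ker Ox]; last first.
  by rewrite !inE Ox /=.
apply: (@coset_idr _ M); first by rewrite (subsetP (normal_norm M_normal)) ?inE.
apply: rI; rewrite -gE Ox -(morph1 Omega) gE morph1 //.
Qed.

(** If [Z ^+ i] is in the image of [Omega], then [g Z ^+ i] is in the image of [r], which forces
    [gamma %| i]. *)
Lemma index_macdonald_wamsley i : Z ^+ i \in Omega @* [set: G] -> gamma %| i.
Proof.
have [E [r [g [rM rI gM gE g_i]]]] := bar_extension.
case/morphimP=> x _ _ Zi; apply: (g_i i (coset M x)).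
have gMm: {in [set: W] &, {morph g : x y / x * y}} by move=> ? ? _ _.
by rewrite -(gmorphX gMm) ?inE // Zi gE.
Qed.

(** * The Sylow p-subgroups of [G] and of the kernel *)

Let proj := sylow_proj p [set: G].
Let projM : {in [set: G] &, {morph proj : x y / x * y}} :=
  sylow_projM (G := [set: G]%G) G_nil Gp_sylow.
Let Np := ('ker Omega :&: Gp)%G.
Let a := proj A.
Let b := proj B.
Let u := #[a].
Let v := #[b].
Let q := #|[set: G] / Gp|.
Let a0 := coset Np a.
Let b0 := coset Np b.

Lemma Gp_a : a \in Gp.
Proof. by apply: (sylow_proj_mem (G := [set: G]%G)); rewrite ?inE. Qed.

Lemma Gp_b : b \in Gp.
Proof. by apply: (sylow_proj_mem (G := [set: G]%G)); rewrite ?inE. Qed.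

Lemma gen_ab : <<[set a; b]>> = Gp.
Proof.
have [_ imG _] := sylow_projP (G := [set: G]%G) G_nil Gp_sylow.
have: proj @: <<[set A; B]>> = Gp by rewrite -set_seq2 gen_AB.
rewrite (sylow_proj_gen (G := [set: G]%G) G_nil Gp_sylow) ?subsetT //.
by rewrite imsetU1 imset_set1.
Qed.

(** The universal map of [G] itself, restricted to [Gp], does the job: [a] is a power of [A], and
    the relation on the order makes the same power of [a'] equal to [a']; likewise for [b]. *)
Lemma sylow_macdonald_presentation :
  presented_by Gp [:: a; b] (sylow_macdonald_rels alpha beta gamma u v).
Proof.
case: (G_pres) => _ Rx univ; split; first by rewrite set_seq2 gen_ab.
  have:= gmorph_all_hold projM [:: A; B] _ _ Rx; rewrite /= !inE => /(_ isT).
  rewrite /= !eval_expz_term /= => -[aR [bR _]].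
  by do 4?split; rewrite ?eval_expz_term ?expg_order //= -[[~ b, a]]invgR.
move=> H [|a' [|b' []]] // _ /sylow_macdonald_relsP[/= a'R b'R a'u b'v].
case: (univ H [:: a'; b']) => // [|f fM [fA fB]].
  by rewrite /= !eval_expz_term /= invgR.
exists f => [x y _ _|]; first by apply: fM; rewrite inE.
have fp x y: f x = y -> y ^+ #[proj x] = 1 -> f (proj x) = y.
  rewrite /proj (sylow_projE (G := [set: G]%G) G_nil Gp_sylow) ?inE // => fx y1.
  by rewrite (gmorphX fM) ?inE // fx (expg_constt_eq1 x).
by rewrite /= (fp A a') ?(fp B b').
Qed.

Lemma Np_normal : Np <| Gp.
Proof.
by rewrite /= setIC; apply: normalGI (subsetT Gp) (ker_normal Omega).
Qed.

Lemma proj_defects :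
  proj @: comm_defects A B =
    comm_defects a b.
Proof.
rewrite -imset_comp; apply: eq_imset => i /=; rewrite /twisted_comm.
rewrite projM ?(gmorphV projM) ?inE // !(gmorphR projM) ?inE //.
by rewrite !(gmorphXz projM) ?inE.
Qed.

(** Project the description of ['ker Omega] to [Gp]: a normal subgroup projects onto its
    intersection with [Gp], and a normal closure onto the normal closure of the projected set. *)
Lemma sylow_ker_closure :
  Np :=: normal_closure
           (comm_defects a b) Gp.
Proof.
rewrite -proj_defects.
rewrite -(sylow_proj_normal_closure (G := [set: G]%G) G_nil Gp_sylow).
  rewrite -ker_macdonald_wamsley.
  by rewrite (sylow_proj_normal (G := [set: G]%G) G_nil Gp_sylow) ?ker_normal.
exact: subsetT.
Qed.

Lemma defect_ker i : 1 <= i < gamma ->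
  [~ expgz a (alpha ^+ i)%R, expgz b (mu ^+ i)%R] * [~ a, b]^-1 \in Np.
Proof.
case/andP=> i_gt0 lti; rewrite sylow_ker_closure.
apply: (mem_gen (mem_class_support _ _)); apply/imsetP.
by exists (Ordinal lti); rewrite ?inE.
Qed.

Lemma cosetNpM : {in Gp &, {morph coset Np : x y / x * y}}.
Proof.
by move=> x y Gx Gy; rewrite morphM // (subsetP (normal_norm Np_normal)).
Qed.

Lemma gen_quotient_ab : <<[set a0; b0]>> = Gp / Np.
Proof.
have sabN: [set a; b] \subset 'N(Np).
  by rewrite -gen_subG gen_ab normal_norm ?Np_normal.
rewrite -gen_ab quotient_gen // quotientE morphimEsub //.
by rewrite imsetU1 imset_set1.
Qed.

Lemma quotient_presentation :
  presented_by (Gp / Np) [:: a0; b0] (quotient_rels alpha beta mu gamma u v).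
Proof.
have [_ Rab univ] := sylow_macdonald_presentation.
split; first by rewrite set_seq2 gen_quotient_ab.
  apply/quotient_relsP; split.
    have:= gmorph_all_hold cosetNpM [:: a; b] _ _ Rab; rewrite /= Gp_a Gp_b.
    exact.
  move=> i /defect_ker Ni; apply: divg1_eq.
  have Gab := (Gp_a, Gp_b, mem_expgz Gp).
  rewrite /= -!(gmorphXz cosetNpM) ?Gab // -!(gmorphR cosetNpM) ?Gab //.
  rewrite -(gmorphV cosetNpM) ?groupR ?Gab // -cosetNpM ?groupV ?groupR ?Gab //.
  exact: coset_id.
move=> H [|a' [|b' []]] // _ /quotient_relsP[Rab' Rc].
have [//|f fM [fA fB]] := univ H [:: a'; b'] _ Rab'.
have [|g gM gE] := gmorph_quotient fM Np_normal.
  rewrite sylow_ker_closure; apply: (gmorph_ker_normal_closure fM).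
    rewrite -proj_defects; apply/subsetP=> _ /imsetP[x _ ->].
    by apply: (sylow_proj_mem (G := [set: G]%G)); rewrite ?inE.
  move=> _ /imsetP[i /[!inE] i_gt0 ->].
  have Gab := (Gp_a, Gp_b, mem_expgz Gp).
  rewrite fM ?groupV ?groupR ?Gab // (gmorphV fM) ?groupR ?Gab //.
  rewrite !(gmorphR fM) ?Gab // !(gmorphXz fM) ?Gab // fA fB.
  by rewrite Rc ?mulgV // i_gt0 ltn_ord.
by exists g; rewrite //= !gE ?Gp_a ?Gp_b ?fA ?fB.
Qed.

(** [Np] is the kernel of the restriction of [Omega] to [Gp]. *)
Lemma quotient_embedding : exists j : {morphism Gp / Np >-> W},
  'injm j /\ {in Gp, forall x, j (coset Np x) = Omega x}.
Proof.
have OM: {in Gp &, {morph Omega : x y / x * y}}.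
  by move=> x y _ _; rewrite OmegaM ?inE.
have [|j jM jE] := gmorph_quotient OM Np_normal.
  by move=> x /setIP[/mker].
exists (Morphism jM); split=> //.
apply/subsetP=> _ /morphpreP[/morphimP[x Nx Gx ->]].
rewrite !inE /= jE // => /eqP Ox; apply/eqP/coset_id; rewrite inE Gx andbT.
by apply/kerP; rewrite ?inE.
Qed.

(** * A Sylow p-subgroup of [W] *)

Let J := (Omega @* [set: G])%G.
Let Jp := (Omega @* Gp)%G.
(** Modulo [J], [Z] has order [gamma = p ^ n * k], so its [k]-th power has order [p ^ n]. The factor
    [q], prime to [p], preserves this order and brings the [p ^ n]-th power into [Jp]. *)
Let d0 := Z ^+ (q * k).
Let Wp := (Jp <*> <[d0]>)%G.

Lemma gen_XYZ : <<[set:: [:: X; Y; Z]]>> = [set: W].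
Proof. by case: W_pres. Qed.

Lemma J_gen : J = <<[set X; Y]>> :> {set W}.
Proof.
have:= morphim_gen Omega (subsetT [set:: [:: A; B]]); rewrite gen_AB /= => ->.
by rewrite set_seq2 morphimEsub ?subsetT // imsetU1 imset_set1 OmegaA OmegaB.
Qed.

Lemma J_normal : J <| [set: W].
Proof.
rewrite /normal subsetT -gen_XYZ gen_subG.
have JX : X \in J by rewrite -OmegaA mem_morphim ?inE.
have JY : Y \in J by rewrite -OmegaB mem_morphim ?inE.
have nJ := subsetP (normG J).
apply/subsetP=> x Sx.
have /or3P[] : [|| x == X, x == Y | x == Z] by rewrite !inE in Sx.
- by move/eqP->; apply: nJ.
- by move/eqP->; apply: nJ.
move/eqP->.
(* Normalizing the finite group [J] only requires one inclusion, so conjugation by the inverse of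
   [Z] need not be treated. *)
rewrite inE {1}J_gen -genJ gen_subG.
apply/subsetP=> _ /imsetP[y Sy ->]; move: Sy; rewrite !inE => /orP[] /eqP->.
  by rewrite X_conj mem_expgz.
by rewrite Y_conj mem_expgz.
Qed.

Lemma Jp_sylow : p.-Sylow(J) Jp.
Proof. exact: morphim_pHall (subsetT Gp) Gp_sylow. Qed.

(** The Sylow subgroup of the nilpotent group [J] is characteristic in it, and [J] is normal in
    [W]. *)
Lemma Jp_normal : Jp <| [set: W].
Proof.
have nilJ : nilpotent J by apply: morphim_nil.
apply: char_normal_trans J_normal.
by rewrite (nilpotent_Hall_pcore nilJ Jp_sylow) pcore_char.
Qed.

Lemma Z_expJ i : (Z ^+ i \in J) = (gamma %| i).
Proof.
apply/idP/idP => [|/dvdnP[t ->]].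
  exact: index_macdonald_wamsley.
rewrite mulnC expgnA Z_gamma groupX // J_gen.
by rewrite groupR ?mem_gen ?inE ?eqxx ?orbT.
Qed.

(** As [X] and [Y] lie in [J], the quotient by [J] is generated by the class of [Z], whose order is
    [gamma] by [Z_expJ]. *)
Lemma card_W : #|[set: W]| = (gamma * #|J|)%N.
Proof.
have nJZ : Z \in 'N(J) by rewrite (subsetP (normal_norm J_normal)) ?inE.
rewrite -(Lagrange (normal_sub J_normal)) mulnC; congr (_ * _)%N.
rewrite -card_quotient ?normal_norm ?J_normal //.
have ->: [set: W] / J = <[coset J Z]>.
  rewrite -gen_XYZ; apply/eqP; rewrite eqEsubset cycle_subG.
  rewrite mem_quotient ?andbT ?mem_gen ?inE ?eqxx ?orbT //.
  have nJ : [set:: [:: X; Y; Z]] \subset 'N(J).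
    by rewrite (subset_trans (subsetT _) (normal_norm J_normal)).
  rewrite quotient_gen // gen_subG; apply/subsetP=> _ /morphimP[x _ Sx ->].
  have J1 y : y \in [set X; Y] -> coset J y \in <[coset J Z]>.
    by move=> ?; rewrite (coset_id (A := J)) ?group1 // J_gen mem_gen.
  have /or3P[] : [|| x == X, x == Y | x == Z] by rewrite !inE in Sx.
  - by move/eqP->; apply: J1; rewrite !inE eqxx.
  - by move/eqP->; apply: J1; rewrite !inE eqxx orbT.
  by move/eqP->; apply: cycle_id.
have nX i : (coset J Z) ^+ i = 1 <-> gamma %| i.
  rewrite -morphX // -Z_expJ; split=> [|]; last exact: coset_id.
  by apply: coset_idr; rewrite groupX.
apply/eqP; rewrite -orderE eqn_dvd order_dvdn; apply/andP; split.
  exact/eqP/nX.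
exact/nX/expg_order.
Qed.

Lemma q_p' : coprime q p.
Proof.
case/and3P: (Gp_sylow) => _ _ p'i.
rewrite /q card_quotient; last first.
  exact: normal_norm (nilpotent_Sylow_normal (G := [set: G]%G) G_nil Gp_sylow).
by rewrite coprime_sym prime_coprime // -p'natE.
Qed.

Lemma d0_expJ i : d0 ^+ i \in J -> p ^ n %| i.
Proof.
rewrite -expgnA Z_expJ gammaE mulnAC dvdn_pmul2r; last first.
  by move: gamma_gt0; rewrite gammaE muln_gt0 => /andP[].
by rewrite Gauss_dvdr // coprimeXl // coprime_sym q_p'.
Qed.

Lemma d0_norm : d0 \in 'N(Jp).
Proof. by rewrite (subsetP (normal_norm Jp_normal)) ?inE. Qed.

Lemma Omega_gen : <<[set Omega a; Omega b]>> = Jp.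
Proof.
have sab : [set a; b] \subset [set: G] by apply: subsetT.
have:= morphim_gen Omega sab; rewrite gen_ab /= => ->.
by rewrite morphimEsub // imsetU1 imset_set1.
Qed.

Lemma Omega_mem x : x \in Gp -> Omega x \in Jp.
Proof. by move=> Gx; rewrite mem_morphim ?inE. Qed.

(** The left side is [Z ^+ (gamma * q)], that is the image of [[~ A, B] ^+ q]; and the [q]-th powers
    of an element of [G] and of its projection coincide. *)
Lemma d0_pn : d0 ^+ (p ^ n) = [~ Omega a, Omega b] ^+ q.
Proof.
rewrite -!(gmorphR OmegaM) ?inE //.
rewrite -(gmorphR projM) ?inE // -(gmorphX OmegaM) ?inE //.
rewrite -(expg_sylow_proj (G := [set: G]%G) G_nil Gp_sylow) ?inE //.
rewrite (gmorphX OmegaM) ?inE // morphR ?inE // OmegaA OmegaB.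
rewrite -Z_gamma -!expgnA gammaE; congr (_ ^+ _).
by rewrite -mulnA mulnC [(k * _)%N]mulnC.
Qed.

Lemma d0_expJp i : (d0 ^+ i \in Jp) = (p ^ n %| i).
Proof.
apply/idP/idP=> [Ji | /dvdnP[t ->]].
  by apply/d0_expJ/(subsetP (pHall_sub Jp_sylow)).
rewrite mulnC expgnA d0_pn !groupX // -Omega_gen.
by rewrite groupR ?mem_gen ?inE ?eqxx ?orbT.
Qed.

Lemma Wp_quotient : Wp / Jp = <[coset Jp d0]>.
Proof.
by rewrite quotientYidl ?cycle_subG ?d0_norm // quotient_cycle ?d0_norm.
Qed.

Lemma Jp_Wp : Jp <| Wp.
Proof. exact: normalS (joing_subl _ _) (subsetT _) Jp_normal. Qed.

Lemma card_Wp_quotient : #|Wp / Jp| = (p ^ n)%N.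
Proof.
have nX i : (coset Jp d0) ^+ i = 1 <-> p ^ n %| i.
  rewrite -morphX ?d0_norm // -d0_expJp; split=> [|]; last exact: coset_id.
  by apply: coset_idr; rewrite groupX ?d0_norm.
apply/eqP; rewrite Wp_quotient -orderE eqn_dvd order_dvdn; apply/andP; split.
  exact/eqP/nX.
exact/nX/expg_order.
Qed.

Lemma card_Wp : #|Wp| = (p ^ n * #|Jp|)%N.
Proof.
rewrite -(Lagrange (normal_sub Jp_Wp)) mulnC.
by rewrite -card_quotient ?(normal_norm Jp_Wp) // card_Wp_quotient.
Qed.

Lemma card_W_p : (#|[set: W]|`_p)%N = (p ^ n * #|Jp|)%N.
Proof.
have k_gt0 : 0 < k by move: gamma_gt0; rewrite gammaE muln_gt0 => /andP[].
have pn_gt0 : 0 < p ^ n by rewrite expn_gt0 prime_gt0.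
rewrite card_W partnM // -(card_Hall Jp_sylow); congr (_ * _)%N.
rewrite gammaE partnM // part_pnat_id; last by rewrite pnatX pnat_id.
by rewrite part_p'nat ?muln1 // p'natE.
Qed.

(** The order decides: it is the full p-part of [gamma * #|J|]. *)
Lemma Wp_sylow : p.-Sylow([set: W]) Wp.
Proof. by rewrite pHallE subsetT card_Wp card_W_p /=. Qed.

(** [a] and [b] are powers of [A] and [B], and the power laws for conjugation of [X] and [Y] by [Z]
    pass to powers. *)
Lemma Omega_ab_conj :
  Omega a ^ d0 = expgz (Omega a) (alpha ^+ (q * k))%R /\
  Omega b ^ d0 = expgz (Omega b) (mu ^+ (q * k))%R.
Proof.
rewrite /a /b /proj !(sylow_projE (G := [set: G]%G) G_nil Gp_sylow) ?inE //.
rewrite !(gmorphX OmegaM) ?inE // OmegaA OmegaB.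
by split; apply/expgz_conj_iter/expgz_conjX; rewrite ?X_conj //
  Y_conj.
Qed.

(** * The presentation of the Sylow subgroup [Wp], and its consequences *)

Section Embedding.

Context {j : {morphism Gp / Np >-> W}}.
Hypotheses (injj : 'injm j) (jE : {in Gp, forall x, j (coset Np x) = Omega x}).

Lemma j_image : j @* (Gp / Np) = Jp.
Proof.
apply/setP=> y; apply/morphimP/morphimP => [[_ _ /morphimP[x Nx Gx ->] ->]|].
  by exists x; rewrite ?inE ?jE.
case=> x _ Gx ->; exists (coset Np x); rewrite ?mem_quotient //.
by rewrite jE.
Qed.

Lemma card_Jp : (#|Jp| * #|Np|)%N = #|Gp|.
Proof.
rewrite -(Lagrange (normal_sub Np_normal)) mulnC; congr (_ * _)%N.
by rewrite -card_quotient ?normal_norm ?Np_normal // -j_image card_injm.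
Qed.

Lemma j_a0 : j a0 = Omega a. Proof. exact: jE Gp_a. Qed.
Lemma j_b0 : j b0 = Omega b. Proof. exact: jE Gp_b. Qed.

(** The universal map of [Gp / Np] is transported to [Jp] along the inverse of [j], then extended to
    [Wp] by [d0 |-> d']. The relations for conjugation by [d0] make it compatible on generators. *)
Lemma wamsley_sylow_presentation :
  presented_by Wp [:: j a0; j b0; d0]
    (sylow_wamsley_rels alpha beta mu gamma u v p n k q).
Proof.
have [_ Rq univ] := quotient_presentation.
have a0q : a0 \in Gp / Np by rewrite mem_quotient ?Gp_a.
have b0q : b0 \in Gp / Np by rewrite mem_quotient ?Gp_b.
have jM : {in Gp / Np &, {morph j : x y / x * y}} := morphM j.
have ab0q : all [in Gp / Np] [:: a0; b0] by rewrite /= a0q b0q.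
have Rj := gmorph_all_hold jM _ _ ab0q Rq.
have [da db] := Omega_ab_conj.
split.
- rewrite j_a0 j_b0 /= -Omega_gen joing_idl joing_idr joingE; congr <<_>>.
  by apply/setP=> x; rewrite !inE orbA.
- apply/sylow_wamsley_relsP; split;
    [| by rewrite /= j_a0 | by rewrite /= j_b0 | by rewrite /= j_a0 j_b0 d0_pn].
  apply/quotient_relsP; move/quotient_relsP: Rj => [Rj1 Rj2]; split=> //.
  by apply/sylow_macdonald_relsP; move/sylow_macdonald_relsP: Rj1.
move=> H [|a' [|b' [|d' []]]] // _ /sylow_wamsley_relsP[Rab /= da' db' dpn'].
have [//||f fM [fa fb]] := univ H [:: a'; b'].
  move/quotient_relsP: Rab => [R1 R2]; apply/quotient_relsP; split=> //.
  by apply/sylow_macdonald_relsP; move/sylow_macdonald_relsP: R1.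
pose g x := f (invm injj x).
have gM : {in Jp &, {morph g : x y / x * y}}.
  move=> x y; rewrite -j_image => Jx Jy; rewrite /g morphM //.
  have invQ z : z \in j @* (Gp / Np) -> invm injj z \in Gp / Np.
    by case/morphimP=> t _ Qt ->; rewrite invmE.
  by rewrite fM ?invQ.
have ga : g (Omega a) = a' by rewrite -j_a0 /g invmE.
have gb : g (Omega b) = b' by rewrite -j_b0 /g invmE.
have Jab := (Omega_mem _ Gp_a, Omega_mem _ Gp_b).
have gd : {in Jp, forall x, g (x ^ d0) = g x ^ d'}.
  rewrite -{1}Omega_gen.
  apply: (gmorph_eq_gen (f := fun x => g (x ^ d0)) (g := fun x => g x ^ d') Jp).
  - by move=> x y Jx Jy; rewrite conjMg gM ?memJ_norm ?d0_norm.
  - by move=> x y Jx Jy; rewrite gM ?conjMg.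
  - by rewrite -gen_subG Omega_gen.
  move=> x; rewrite !inE => /orP[] /eqP->.
    by rewrite da (gmorphXz gM) ?Jab // ga.
  by rewrite db (gmorphXz gM) ?Jab // gb.
have [|F [FM FJ Fd]] := gmorph_extend_cycle gM d0_norm gd (e := d').
  (* A power of [d0] in [Jp] is a power of [d0 ^+ (p ^ n)], whose image is prescribed by the last
     relation. *)
  move=> i; rewrite d0_expJp => /dvdnP[t ->]; rewrite mulnC !expgnA d0_pn dpn'.
  rewrite !(gmorphX gM) ?groupX ?groupR ?Jab //.
  by rewrite (gmorphR gM) ?Jab // ga gb.
by exists F => //; rewrite /= j_a0 j_b0 (FJ _ Jab.1) (FJ _ Jab.2) ga gb Fd.
Qed.

End Embedding.

Lemma gen_j_ab (j : {morphism Gp / Np >-> W}) :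
  {in Gp, forall x, j (coset Np x) = Omega x} -> <<[set j a0; j b0]>> = Jp.
Proof. by move=> jE; rewrite (j_a0 jE) (j_b0 jE) Omega_gen. Qed.

Lemma wamsley_sylow :
  exists (Wp : {group W}) (j : {morphism Gp / Np >-> W}) (d0 : W),
    [/\ p.-Sylow([set: W]) Wp,
        'injm j /\ j @* (Gp / Np) <| Wp,
        presented_by Wp [:: j a0; j b0; d0]
          (sylow_wamsley_rels alpha beta mu gamma u v p n k q),
        <<[set j a0; j b0]>> <| Wp /\
        (cyclic (Wp / <<[set j a0; j b0]>>) /\
         #|Wp / <<[set j a0; j b0]>>| = (p ^ n)%N)
      & #|Wp| = ((p ^ n * #|Gp|) %/ #|Np|)%N].
Proof.
have [j [injj jE]] := quotient_embedding.
exists Wp, j, d0; rewrite (gen_j_ab _ jE); split.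
- exact: Wp_sylow.
- by rewrite (j_image jE) Jp_Wp.
- exact: wamsley_sylow_presentation.
- by rewrite Jp_Wp card_Wp_quotient Wp_quotient cycle_cyclic.
by rewrite -(card_Jp injj jE) mulnA mulnK ?cardG_gt0 // card_Wp.
Qed.

(** Here [n = 0], so [Jp] is already a Sylow subgroup of [W]; being normal, it is the only one. *)
Lemma wamsley_unique_sylow : ~~ (p %| gamma)%N ->
  exists Wp : {group W}, 'Syl_p([set: W]) = [set Wp] /\ Gp / Np \isog Wp.
Proof.
move=> p_ndvd_gamma; have n0 : n = 0.
  move: p_ndvd_gamma; rewrite gammaE; case: (n) => // m.
  by rewrite expnS -mulnA dvdn_mulr.
have sylJ : p.-Sylow([set: W]) Jp.
  by rewrite pHallE subsetT card_W_p n0 mul1n /=.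
have [j [injj jE]] := quotient_embedding.
exists Jp; split; last by apply/isogP; exists j; rewrite ?(j_image jE).
have JpE := normal_Hall_pcore sylJ Jp_normal.
apply/setP=> Q; rewrite !inE; apply/idP/eqP => [sylQ | -> //].
apply/val_inj; rewrite /= -JpE.
by apply: eq_Hall_pcore sylQ; rewrite JpE.
Qed.

End MacdonaldWamsley.

Theorem theorem2p3
  (alpha beta mu : int) (gamma p n k : nat)
  (W : finGroupType) (X Y Z : W)
  (G : finGroupType) (A B : G)
  (Omega : {morphism [set: G] >-> W}) (Gp : {group G})
  (gamma_gt0 : (0 < gamma)%N)
  (alpha_neq1 : (alpha ^+ gamma)%R <> 1%R)
  (beta_neq1 : (beta ^+ gamma)%R <> 1%R)
  (p_prime : prime p)
  (p_dvd : (p %| ((alpha ^+ gamma - 1) * (beta ^+ gamma - 1))%R)%Z)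
  (gammaE : gamma = (p ^ n * k)%N)
  (p_ndvd_k : ~~ (p %| k)%N)
  (W_pres : presented_by [set: W] [:: X; Y; Z] (wamsley_rels alpha beta gamma))
  (G_pres : presented_by [set: G] [:: A; B] (macdonald_rels alpha beta gamma))
  (G_nil : nilpotent [set: G])
  (OmegaA : Omega A = X) (OmegaB : Omega B = Y)
  (mu_inv : ((mu * beta)%R = 1 %[mod #[B]])%Z)
  (Gp_sylow : p.-Sylow([set: G]) Gp) :
  let Np := ('ker Omega :&: Gp)%G in
  let a := sylow_proj p [set: G] A in
  let b := sylow_proj p [set: G] B in
  let u := #[a] in
  let v := #[b] in
  let q := #|[set: G] / Gp| in
  let a0 := coset Np a in
  let b0 := coset Np b in
  [/\ presented_by Gp [:: a; b] (sylow_macdonald_rels alpha beta gamma u v),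
      Np :=: normal_closure
        [set [~ expgz a (alpha ^+ i)%R, expgz b (mu ^+ i)%R] * [~ a, b]^-1
           | i : 'I_gamma & (1 <= i)%N] Gp,
      presented_by (Gp / Np) [:: a0; b0]
        (quotient_rels alpha beta mu gamma u v),
      exists (Wp : {group W}) (j : {morphism Gp / Np >-> W}) (d0 : W),
        [/\ p.-Sylow([set: W]) Wp,
            'injm j /\ j @* (Gp / Np) <| Wp,
            presented_by Wp [:: j a0; j b0; d0]
              (sylow_wamsley_rels alpha beta mu gamma u v p n k q),
            <<[set j a0; j b0]>> <| Wp /\
            (cyclic (Wp / <<[set j a0; j b0]>>) /\
             #|Wp / <<[set j a0; j b0]>>| = (p ^ n)%N)
          & #|Wp| = ((p ^ n * #|Gp|) %/ #|Np|)%N]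
    & ~~ (p %| gamma)%N ->
      exists Wp : {group W},
        'Syl_p([set: W]) = [set Wp] /\ Gp / Np \isog Wp].
Proof.
move=> Np a b u v q a0 b0; split.
- exact: sylow_macdonald_presentation.
- exact: (sylow_ker_closure gamma_gt0 W_pres G_pres).
- exact: (quotient_presentation gamma_gt0 W_pres).
- exact: (wamsley_sylow gamma_gt0 p_prime gammaE p_ndvd_k W_pres G_pres
           G_nil OmegaA OmegaB mu_inv Gp_sylow).
exact: (wamsley_unique_sylow gamma_gt0 p_prime gammaE p_ndvd_k W_pres G_pres
           G_nil OmegaA OmegaB mu_inv Gp_sylow).
Qed.
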